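(* Let $r\ge 0$ be a fixed integer, let $\alpha=(\alpha_0,\alpha_1,\dots,\alpha_r)\in\mathbb{R}^{r+1}$ with all $\alpha_i\ge 0$ be fixed (independent of $n$), and suppose that $\alpha\in\mathfrak{D}_k$ for some $k\in\{0,1,\dots,r\}$. For each positive integer $n$, let $Y\in\Omega_n^r$ be a random simplicial complex with respect to the probability measure $\mathbb{P}_{r,\mathfrak{p}}$ with $\mathfrak{p}=(p_0,p_1,\dots,p_r)$, $p_i=n^{-\alpha_i}$, and regard the Betti numbers $b_j:\Omega_n^r\to\mathbb{R}$, $j=0,1,\dots,r$, as random variables on this probability space, with expectations $\mathbb{E}(b_j)$. Then: 1. For all $n$ large enough, $$\mathbb{E}(b_k)\ \ge\ \frac{n^{e(\alpha)}}{(r+1)!}\cdot \mathbb{E}(b_j)\qquad\text{for every } j\in\{0,1,\dots,r\},\ j\ne k.$$ 2. As $n\to\infty$, $$\mathbb{E}(b_k)\ \sim\ \frac{1}{(k+1)!}\cdot n^{\,k+1-\sum_{i=0}^k\psi_i(\alpha)}.$$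
   Context: **The probability space.** Let $\Delta_n$ denote the simplex with vertex set $\{1,\dots,n\}$, viewed as an abstract simplicial complex of dimension $n-1$. For an integer $r\ge 0$, $\Omega_n^r$ is the set of all simplicial subcomplexes $Y\subset\Delta_n$ with $\dim Y\le r$ (the empty complex is included, and a subcomplex need not contain all the vertices). For $Y\in\Omega_n^r$, $f_i(Y)$ denotes the number of $i$-dimensional simplexes of $\Delta_n$ contained in $Y$. An external face of $Y$ is a simplex $\sigma\subset\Delta_n$ such that $\sigma\not\subset Y$ but the boundary $\partial\sigma$ is contained in $Y$ (in particular, every vertex of $\Delta_n$ not in $Y$ is an external face of dimension $0$); $e_i(Y)$ denotes the number of $i$-dimensional external faces of $Y$. For $\mathfrak{p}=(p_0,\dots,p_r)$ with $0\le p_i\le 1$ and $q_i=1-p_i$, the probability function on $\Omega_n^r$ is $$\mathbb{P}_{r,\mathfrak{p}}(Y)=\prod_{i=0}^r p_i^{f_i(Y)}\cdot\prod_{i=0}^r q_i^{e_i(Y)},$$ with the convention $0^0=1$. This is a probability measure on the finite set $\Omega_n^r$. **Betti numbers.** $b_j(Y)=\dim_{\mathbb{Q}}H_j(Y;\mathbb{Q})$ is the $j$-th (unreduced) Betti number of $Y$. **The functions $\psi_k$ and the domains $\mathfrak{D}_k$.** Let $\mathbb{R}^{r+1}_+=\{\alpha=(\alpha_0,\dots,\alpha_r)\in\mathbb{R}^{r+1}:\alpha_i\ge 0 \text{ for all } i\}$. For $k=0,\dots,r$ put $$\psi_k(\alpha)=\sum_{i=0}^r\binom{k}{i}\alpha_i,$$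 with the conventions $\binom{k}{i}=0$ for $i>k$ and $\binom{0}{0}=1$. Define $$\mathfrak{D}_k=\{\alpha\in\mathbb{R}^{r+1}_+ : \psi_k(\alpha)<1<\psi_{k+1}(\alpha)\}\quad (k=0,1,\dots,r-1),\qquad \mathfrak{D}_r=\{\alpha\in\mathbb{R}^{r+1}_+ : \psi_r(\alpha)<1\}.$$ **The quantity $e(\alpha)$.** $e(\alpha)=\min_{0\le i\le r}|1-\psi_i(\alpha)|$. (This real number is not to be confused with the counts $e_i(Y)$.) **Asymptotics.** $a_n\sim b_n$ means $a_n/b_n\to 1$ as $n\to\infty$. *)

(* Defs.v *)
From HB Require Import structures.
From mathcomp Require Import all_boot all_order all_algebra.
From mathcomp Require Import all_classical all_reals all_analysis.
From mathcomp Require Import ring.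
Import Order.TTheory GRing.Theory Num.Theory.
Import numFieldNormedType.Exports.

Set Implicit Arguments.
Unset Strict Implicit.
Unset Printing Implicit Defensive.

Local Open Scope ring_scope.

(* The vertices 1, ..., n are rendered by 'I_n. A simplex is a nonempty
   set of vertices, of dimension its cardinality minus one; a subcomplex is
   its set of (nonempty) simplexes, so set0 is the empty complex. *)
Definition is_complex n (Y : {set {set 'I_n}}) : bool :=
  (finset.set0 \notin Y) &&
  [forall sigma in Y, forall tau : {set 'I_n},
     (tau != finset.set0) && (tau \subset sigma) ==> (tau \in Y)].

Definition Omega n r : {set {set {set 'I_n}}} :=
  [set Y : {set {set 'I_n}} |
     is_complex Y && [forall sigma in Y, (#|sigma| <= r.+1)%N]].

Definition faces n (Y : {set {set 'I_n}}) (i : nat) : {set {set 'I_n}} :=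
  [set sigma in Y | #|sigma| == i.+1].

Definition external_face n (Y : {set {set 'I_n}}) (sigma : {set 'I_n}) : bool :=
  [&& sigma != finset.set0, sigma \notin Y &
      [forall tau : {set 'I_n},
         (tau != finset.set0) && (tau \proper sigma) ==> (tau \in Y)]].

Definition external_faces n (Y : {set {set 'I_n}}) (i : nat) :
    {set {set 'I_n}} :=
  [set sigma : {set 'I_n} | external_face Y sigma & #|sigma| == i.+1].

Section Measure.
Variables (R : realType) (n r : nat) (p : 'I_r.+1 -> R).

(* x ^+ 0 = 1 for every x, which gives the convention 0^0 = 1. *)
Definition prob (Y : {set {set 'I_n}}) : R :=
  (\prod_(i < r.+1) p i ^+ #|faces Y i|) *
  (\prod_(i < r.+1) (1 - p i) ^+ #|external_faces Y i|).

Definition mean (X : {set {set 'I_n}} -> R) : R :=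
  \sum_(Y in Omega n r) prob Y * X Y.

End Measure.

(* Rational chains on all sets of vertices at once; the chains of a given
   degree of a complex Y are a subspace, see chains. *)
Notation chain n := {ffun {set 'I_n} -> rat^o}.

Definition simplex_chain n (sigma : {set 'I_n}) : chain n :=
  [ffun tau => (tau == sigma)%:R].

(* The coefficient of tau in the boundary of v |: tau is (-1)^i, where i is the
   position, starting from 0, of v among the vertices of v |: tau in increasing
   order. The coefficient of set0 is 0 because homology is not reduced. *)
Definition boundary_fun n (c : chain n) : chain n :=
  [ffun tau : {set 'I_n} => if tau == finset.set0 then 0 else
     \sum_(v | v \notin tau)
        (-1) ^+ #|[set w in tau | (w < v)%N]| * c (v |: tau)].

Fact boundary_fun_is_linear n : linear (@boundary_fun n).
Proof.
move=> a c d; apply/ffunP => tau; rewrite !ffunE.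
case: ifP => _; first by rewrite scaler0 addr0.
rewrite scaler_sumr -big_split /=; apply: eq_bigr => v _.
by rewrite !ffunE mulrDr scalerAr.
Qed.

HB.instance Definition _ n := GRing.isLinear.Build rat (chain n) (chain n) _
  (@boundary_fun n) (@boundary_fun_is_linear n).

Definition boundary n : 'End(chain n) := linfun (@boundary_fun n).

Section Homology.
Variables (n : nat) (Y : {set {set 'I_n}}) (j : nat).

Definition chains (i : nat) : {vspace chain n} :=
  <<[seq simplex_chain sigma | sigma in faces Y i]>>%VS.

Definition cycles : {vspace chain n} := (chains j :&: lker (boundary n))%VS.

Definition boundaries : {vspace chain n} := (boundary n @: chains j.+1)%VS.

(* A complement of boundaries in cycles represents the quotient
   H_j(Y; Q) = cycles / boundaries. *)
Definition homology : {vspace chain n} := (cycles :\: boundaries)%VS.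

Definition betti : nat := \dim homology.

End Homology.

Lemma mem_chains n (Y : {set {set 'I_n}}) i (c : chain n) :
  (c \in chains Y i) = [forall tau, (tau \notin faces Y i) ==> (c tau == 0)].
Proof.
apply/idP/forallP => [cY tau|cY].
  apply/implyP => tauY; rewrite (coord_span cY) sum_ffunE big1// => k _.
  set l := (X in nth _ X _).
  have : l`_k \in [seq simplex_chain s | s in faces Y i].
    by apply/mem_nth; rewrite size_map -cardE.
  case/mapP => s; rewrite mem_enum => sY /= e.
  rewrite !ffunE e !ffunE; case: eqP => [ts|]; first by rewrite -ts (negbTE tauY) in sY.
  by rewrite scaler0.
have -> : c = \sum_(s in faces Y i) c s *: simplex_chain s.
  apply/ffunP => t; rewrite sum_ffunE.
  have [tY|tY] := boolP (t \in faces Y i).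
    rewrite (bigD1 t)//= !ffunE eqxx big1 ?addr0 => [|s /andP[_ /negbTE st]].
      by rewrite /GRing.scale /= mulr1.
    by rewrite !ffunE eq_sym st scaler0.
  have /eqP -> := implyP (cY t) tY.
  rewrite big1// => s sY; rewrite !ffunE; case: eqP => [ts|]; last by rewrite scaler0.
  by rewrite ts sY in tY.
apply: memv_suml => s sY; apply/memvZ/memv_span/mapP; exists s => //.
by rewrite mem_enum.
Qed.

Lemma cardlt n (tau : {set 'I_n}) (v w : 'I_n) : v \notin tau ->
  #|[set x in v |: tau | (x < w)%N]| = ((v < w) + #|[set x in tau | (x < w)%N]|)%N.
Proof.
move=> vt; have [vw|vw] := boolP (v < w)%N.
  have -> : [set x in v |: tau | (x < w)%N] = v |: [set x in tau | (x < w)%N].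
    by apply/setP => x; rewrite !inE; case: eqVneq => // ->; rewrite vw.
  by rewrite cardsU1 !inE (negbTE vt).
congr #|pred_of_set _|; apply/setP => x; rewrite !inE.
by case: eqVneq => //= ->; rewrite (negbTE vw) (negbTE vt).
Qed.

Lemma boundary_boundary n (c : chain n) : boundary_fun (boundary_fun c) = 0.
Proof.
apply/ffunP => tau; rewrite [RHS]ffunE [LHS]ffunE; case: ifP => // _.
pose F (v w : 'I_n) : rat := (-1) ^+ #|[set x in tau | (x < v)%N]| *
   ((-1) ^+ #|[set x in v |: tau | (x < w)%N]| * c (w |: (v |: tau))).
have anti v w : v \notin tau -> w \notin tau -> v != w -> F v w = - F w v.
  move=> vt wt vw; rewrite /F !cardlt// (finset.setUCA [set w]) !exprD.
  have : (v < w)%N = ~~ (w < v)%N.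
    by rewrite -leqNgt ltn_neqAle; rewrite -[_ == _ :> nat]/(v == w) vw.
  by move=> ->; case: (w < v)%N => /=; ring.
set S := LHS.
have SE : S = \sum_(v | v \notin tau) \sum_(w | (w \notin tau) && (v != w)) F v w.
  apply: eq_bigr => v vt; rewrite ffunE.
  case: ifP => [/eqP/setP/(_ v)|_]; first by rewrite !inE eqxx.
  rewrite mulr_sumr; apply: eq_bigl => w; by rewrite !inE negb_or andbC eq_sym.
have : S = - S.
  rewrite {1}SE (exchange_big_dep (fun w => w \notin tau)) /=; last by move=> ? ? ? /andP[].
  rewrite SE -sumrN; apply: eq_bigr => v vt; rewrite -sumrN.
  apply: eq_big => [w|w]; first by rewrite vt (eq_sym w).
  by case/andP=> wt /andP[_ wv]; rewrite anti.
by move=> /eqP; rewrite -subr_eq0 opprK -mulr2n mulrn_eq0 /= => /eqP.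
Qed.

Lemma boundaries_cycles n (Y : {set {set 'I_n}}) j :
  is_complex Y -> (boundaries Y j <= cycles Y j)%VS.
Proof.
move=> /andP[_ /forall_inP cY]; apply/subvP => b /memv_imgP[c cc ->].
rewrite memv_cap memv_ker !lfunE /= boundary_boundary eqxx andbT.
move: cc; rewrite !mem_chains => /forallP cc; apply/forallP => t; apply/implyP => tY.
rewrite ffunE; case: ifPn => // t0; apply/eqP; rewrite big1// => v vt.
suff /(implyP (cc _))/eqP -> : v |: t \notin faces Y j.+1 by rewrite mulr0.
apply: contra tY; rewrite !inE cardsU1 vt add1n eqSS => /andP[vtY ->]; rewrite andbT.
have /forallP/(_ t)/implyP := cY _ vtY; apply.
by rewrite t0 finset.subsetUr.
Qed.

Lemma betti_dim n (Y : {set {set 'I_n}}) j : is_complex Y ->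
  betti Y j = (\dim (cycles Y j) - \dim (boundaries Y j))%N.
Proof.
move=> cY; have /capv_idPr e := boundaries_cycles j cY.
by rewrite -(dimv_cap_compl (cycles Y j) (boundaries Y j)) e addKn.
Qed.

Section Domains.
Variables (R : realType) (r : nat).
Implicit Types alpha : 'I_r.+1 -> R.

Definition psi (k : nat) alpha : R := \sum_(i < r.+1) 'C(k, i)%:R * alpha i.

Definition domainD (k : 'I_r.+1) : set ('I_r.+1 -> R) :=
  [set alpha | [/\ (forall i, 0 <= alpha i), psi k alpha < 1 &
                   ((k < r)%N -> 1 < psi k.+1 alpha)]].

(* The starting value of the iterated minimum is its term of index 0. *)
Definition e_alpha alpha : R :=
  \big[Num.min/`|1 - psi 0 alpha|]_(i < r.+1) `|1 - psi i alpha|.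

Definition p_alpha alpha (n : nat) (i : 'I_r.+1) : R := n%:R `^ (- alpha i).

Definition mean_betti alpha (n j : nat) : R :=
  mean (p_alpha alpha n) (fun Y : {set {set 'I_n}} => (betti Y j)%:R).

End Domains.

(* Main.v *)
Require Import Defs.
From HB Require Import structures.
From mathcomp Require Import all_boot all_order all_algebra.
From mathcomp Require Import all_classical all_reals all_analysis.
From mathcomp Require Import ring lra.
Import Order.TTheory GRing.Theory Num.Theory.
Import numFieldNormedType.Exports.

(** Write f_j for the number of j-dimensional faces of the random complex, b_j
    for its Betti numbers and rho_j for the rank of the boundary map from
    (j+1)-chains to j-chains.

    The expected face numbers are explicit. The random complex is the largest
    complex contained in a random family of simplexes in which every simplex of
    dimension i is present independently with probability p_i ([mean_core]). A
    simplex with j+1 vertices therefore survives with probability the product of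
    the p_i ^ C(j+1, i+1), and for p_i = n^(-alpha_i) this gives

      E f_j = C(n, j+1) n^(-(psi_0 + ... + psi_j)) ~ n^(growth j) / (j+1)!,

    where growth j is the sum of the 1 - psi_i for i <= j ([mean_faces_growth]).
    Since psi is nondecreasing in its index, in the domain D_k the increments
    1 - psi_i are positive up to i = k and negative afterwards, and they are at
    least e(alpha) in absolute value. So growth peaks at k, and every other
    exponent is smaller by at least e(alpha) ([growth_gap]).

    Betti numbers follow face numbers. Rank-nullity gives
    f_(j+1) = b_(j+1) + rho_(j+1) + rho_j and f_0 = b_0 + rho_0, while
    rho_j <= f_j and rho_j <= f_(j+1). Hence b_j <= f_j for every j, and
    f_k - b_k is at most f_(k-1) + f_(k+1), which is negligible against f_k: this
    is the asymptotic equivalence ([mean_betti_cvg]).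

    For the inequality, comparing E b_j <= E f_j with E b_k ~ E f_k leaves a factor
    (r+1)! (j+1)! / (k+1)! to absorb the error term. It is at least 2 unless j = 0
    and k = r. If moreover r >= 2, the exponents differ by at least 2 e(alpha), so
    a factor n^e(alpha) is left over. The only tight case is the comparison
    of b_1 with b_0 for random graphs (r = k = 1): there n^(e(alpha)) E f_0 / 2 is
    itself asymptotic to E f_1, and the crude bound E b_0 <= E f_0 has to be
    improved. The Euler relation b_1 = f_1 - rho_0, b_0 = f_0 - rho_0 together with
    the bound of rho_0 by the degree of a vertex gives the required gain
    ([graph_dominance]). *)

Set Implicit Arguments.
Unset Strict Implicit.
Unset Printing Implicit Defensive.

Local Open Scope ring_scope.

(** * The random complex as the core of an independent family *)

Section ProductMeasure.
Variables (R : comPzRingType) (T : finType) (p : T -> R).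
Implicit Types A B X : {set T}.

(** The law of a random subset of T that contains each s independently with
    probability p s. *)
Definition weight X : R := \prod_s (if s \in X then p s else 1 - p s).

(** Expand the product over all s of F s + G s: putting F = 0 on B and G = 0 on A
    kills exactly the subsets X that violate the two constraints, and where neither
    constraint applies the factor is p s + (1 - p s) = 1. *)
Lemma sum_weight A B : [disjoint A & B] ->
  \sum_(X : {set T} | (A \subset X) && [disjoint B & X]) weight X =
  \prod_(s in A) p s * \prod_(s in B) (1 - p s).
Proof.
move=> dAB.
pose F s := if s \in B then 0 else p s.
pose G s := if s \in A then 0 else 1 - p s.
have -> : \prod_(s in A) p s * \prod_(s in B) (1 - p s) = \prod_s (F s + G s).
  rewrite (big_mkcond (mem A)) (big_mkcond (mem B)) -big_split /=.
  apply: eq_bigr => s _; rewrite /F /G.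
  have [sA|sA] := boolP (s \in A); have [sB|sB] := boolP (s \in B).
  - by have := disjointFr dAB sA; rewrite sB.
  - by rewrite mulr1 addr0.
  - by rewrite mul1r add0r.
  - by rewrite mul1r addrC subrK.
rewrite bigA_distr big_mkcond /=; apply: eq_bigr => X _.
case: ifP => [/andP[/fintype.subsetP AX dBX]|/negbT].
  apply: eq_bigr => s _; rewrite /F /G.
  case: ifPn => sX; first by rewrite (disjointFl dBX sX).
  by rewrite ifN //; apply: contra sX; apply: AX.
rewrite negb_and => /orP[/subsetPn[s sA sX]|].
  by rewrite (bigD1 s) //= (negbTE sX) /G sA mul0r.
rewrite disjoint_sym disjoint_subset => /subsetPn[s sX].
rewrite unfold_in /= negbK => sB.
by rewrite (bigD1 s) //= sX /F sB mul0r.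
Qed.

End ProductMeasure.

Section Core.
Variable n : nat.
Implicit Types (X Y : {set {set 'I_n}}) (s t : {set 'I_n}).

Definition nonempty_subsets s : {set {set 'I_n}} :=
  [set t : {set 'I_n} | (t != finset.set0) && (t \subset s)].

(** The largest complex contained in X. *)
Definition core X : {set {set 'I_n}} :=
  [set s : {set 'I_n} | (s != finset.set0) && (nonempty_subsets s \subset X)].

Lemma nonempty_subsetsS s t :
  t \subset s -> nonempty_subsets t \subset nonempty_subsets s.
Proof.
move=> ts; apply/fintype.subsetP => u; rewrite !inE => /andP[-> ut].
exact: fintype.subset_trans ut ts.
Qed.

Lemma core_is_complex X : is_complex (core X).
Proof.
apply/andP; split; first by rewrite inE eqxx.
apply/forall_inP => s; rewrite inE => /andP[_ sX].
apply/forallP => t; apply/implyP => /andP[t0 ts]; rewrite inE t0.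
exact: fintype.subset_trans (nonempty_subsetsS ts) sX.
Qed.

Lemma core_sub X : core X \subset X.
Proof.
apply/fintype.subsetP => s; rewrite inE => /andP[s0 /fintype.subsetP]; apply.
by rewrite inE s0 subxx.
Qed.

Lemma complex_face Y s t :
  is_complex Y -> s \in Y -> t != finset.set0 -> t \subset s -> t \in Y.
Proof.
case/andP=> _ /forall_inP cY sY t0 ts.
by apply: (implyP (forallP (cY _ sY) t)); rewrite t0.
Qed.

(** If core X were larger than Y, a simplex of least cardinality in the
    difference would be an external face of Y belonging to X. This is where
    external faces enter the formula for [prob]. *)
Lemma core_eq X Y : is_complex Y ->
  (core X == Y) =
  (Y \subset X) && [disjoint [set s | external_face Y s] & X].
Proof.
move=> cY; have Y0 s : s \in Y -> s != finset.set0.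
  by case/andP: cY => Y0 _; apply: contraTneq => ->.
apply/eqP/andP => [<-|[/fintype.subsetP YX dX]].
  split; first exact: core_sub.
  rewrite disjoint_subset; apply/fintype.subsetP => s.
  rewrite inE => /and3P[s0 sY /forallP eS].
  apply: contra sY => /= sX; rewrite inE s0; apply/fintype.subsetP => t.
  rewrite inE => /andP[t0 ts]; have [->//|tns] := eqVneq t s.
  apply: (fintype.subsetP (core_sub X)); apply: (implyP (eS t)).
  by rewrite t0 finset.properEneq tns.
have YC s : s \in Y -> s \in core X.
  move=> sY; rewrite inE (Y0 _ sY); apply/fintype.subsetP => t; rewrite inE => /andP[t0 ts].
  exact/YX/(complex_face cY sY).
apply/eqP; rewrite finset.eqEsubset; apply/andP; split; last by apply/fintype.subsetP.
apply/fintype.subsetP => s; have [m] := ubnP #|s|; elim: m s => // m IH s sm sC.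
apply: contraTT (fintype.subsetP (core_sub X) _ sC) => sY.
rewrite (disjointFr dX) // inE /external_face sY.
have /andP[s0 sX] : (s != finset.set0) && (nonempty_subsets s \subset X).
  by rewrite inE in sC.
rewrite s0 /=; apply/forallP => t; apply/implyP => /andP[t0 ts]; apply: IH.
  by rewrite -ltnS; apply: leq_trans sm; rewrite ltnS fintype.proper_card.
exact: complex_face (core_is_complex X) sC t0 (fintype.proper_sub ts).
Qed.

End Core.

Section Coupling.
Variables (R : realType) (n r : nat) (p : 'I_r.+1 -> R).
Implicit Types (X Y : {set {set 'I_n}}) (s t : {set 'I_n}).

(** Encoded as a sum with at most one term, so that the empty set and the sets of
    dimension above r get probability 0: the independent family then almost surely
    lies in the r-skeleton. *)
Definition simplex_prob s : R := \sum_(i < r.+1 | #|s| == i.+1) p i.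

Lemma simplex_prob_dim s (i : 'I_r.+1) : #|s| = i.+1 -> simplex_prob s = p i.
Proof.
move=> si; rewrite /simplex_prob (big_pred1 i) // => l.
by rewrite si eqSS eq_sym.
Qed.

Lemma simplex_prob_big s : (r.+1 < #|s|)%N -> simplex_prob s = 0.
Proof.
move=> rs; rewrite /simplex_prob big_pred0 // => l.
by apply: contraTF rs => /eqP ->; rewrite -leqNgt.
Qed.

(** Used for p on the faces and for 1 - p on the external faces. An external face
    of a complex of dimension r may have dimension r + 1, and it then contributes
    the factor 1 - 0 = 1: hence the hypothesis on large sets. *)
Lemma prod_by_dim (A : {set {set 'I_n}}) (F : {set 'I_n} -> R) (g : 'I_r.+1 -> R) :
    finset.set0 \notin A ->
    (forall s, s \in A -> (r.+1 < #|s|)%N -> F s = 1) ->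
    (forall s (i : 'I_r.+1), #|s| = i.+1 -> F s = g i) ->
  \prod_(s in A) F s =
  \prod_(i < r.+1) g i ^+ #|[set s in A | #|s| == i.+1]|.
Proof.
move=> A0 F1 Fg.
have -> : \prod_(i < r.+1) g i ^+ #|[set s in A | #|s| == i.+1]| =
          \prod_(i < r.+1) \prod_(s in A | #|s| == i.+1) F s.
  apply: eq_bigr => i _; rewrite -prodr_const.
  apply: eq_big => s; first by rewrite inE.
  by rewrite inE => /andP[_ /eqP si]; rewrite (Fg _ _ si).
rewrite (exchange_big_dep (mem A)) /=; last by move=> i s _ /andP[].
apply: eq_bigr => s sA; rewrite (eq_bigl (fun i : 'I_r.+1 => #|s| == i.+1)); last first.
  by move=> i; rewrite sA.
have s0 : (0 < #|s|)%N by rewrite card_gt0; apply: contraNneq A0 => <-.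
have [sr|rs] := leqP #|s| r.+1.
  have sr' : (#|s|.-1 < r.+1)%N by rewrite prednK.
  rewrite (big_pred1 (Ordinal sr')) // => i.
  apply/eqP/eqP => [si|->]; last by rewrite /= prednK.
  by apply: val_inj; rewrite /= si.
by rewrite (F1 _ sA rs) big1.
Qed.

Lemma prob_core Y : Y \in Omega n r ->
  prob p Y = \sum_(X | core X == Y) weight simplex_prob X.
Proof.
rewrite inE => /andP[cY /forall_inP rY].
under eq_bigl do rewrite core_eq //.
rewrite sum_weight; last first.
  rewrite disjoint_subset; apply/fintype.subsetP => s sY; rewrite unfold_in /= inE.
  by rewrite /external_face sY andbF.
rewrite /prob; congr (_ * _).
  rewrite (@prod_by_dim _ _ p) //; first by case/andP: cY.
    by move=> s /rY; rewrite leqNgt => /negbTE ->.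
  exact: simplex_prob_dim.
rewrite (@prod_by_dim _ _ (fun i => 1 - p i)).
- apply: eq_bigr => i _; congr (_ ^+ #|pred_of_set _|).
  by apply/setP => s; rewrite !inE.
- by rewrite inE /external_face eqxx.
- by move=> s _ /simplex_prob_big ->; rewrite subr0.
- by move=> s i /simplex_prob_dim ->.
Qed.

(** The coupling that replaces the measure on complexes by a product measure.
    Families whose core leaves [Omega n r] contain a simplex of dimension above r
    and hence have weight 0. *)
Lemma mean_core (f : {set {set 'I_n}} -> R) :
  mean p f = \sum_X weight simplex_prob X * f (core X).
Proof.
rewrite (partition_big (@core n) xpredT) //=.
rewrite (bigID (mem (Omega n r))) /= [X in _ + X]big1 ?addr0; last first.
  move=> Y YO; rewrite big1 // => X /eqP XY.
  have : ~~ [forall s in Y, (#|s| <= r.+1)%N].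
    by move: YO; rewrite inE -XY core_is_complex.
  rewrite negb_forall_in => /exists_inP[s sY]; rewrite -ltnNge => rs.
  have sX : s \in X by apply: (fintype.subsetP (core_sub X)); rewrite XY.
  by rewrite /weight (bigD1 s) //= sX simplex_prob_big // !mul0r.
apply: eq_bigr => Y YO; rewrite prob_core // mulr_suml.
by apply: eq_bigr => X /eqP ->.
Qed.

Lemma mean_face s : s != finset.set0 -> (#|s| <= r.+1)%N ->
  mean p (fun Y => (s \in Y)%:R) = \prod_(i < r.+1) p i ^+ 'C(#|s|, i.+1).
Proof.
move=> s0 sr; rewrite mean_core.
transitivity (\sum_(X : {set {set 'I_n}} |
                 (nonempty_subsets s \subset X) && [disjoint finset.set0 & X])
                weight simplex_prob X).
  rewrite [RHS]big_mkcond /=; apply: eq_bigr => X _.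
  rewrite inE s0 /= eq_disjoint0; last first.
    by move=> x; rewrite inE.
  by rewrite andbT; case: ifP; rewrite ?mulr1 ?mulr0.
rewrite sum_weight; last by rewrite disjoint_sym eq_disjoint0 // => x; rewrite inE.
rewrite big_set0 mulr1 (@prod_by_dim _ _ p).
- apply: eq_bigr => i _; rewrite -cards_draws; congr (_ ^+ #|pred_of_set _|).
  apply/setP => t; rewrite !inE; case: (#|t| =P i.+1) => [ti|]; last by rewrite !andbF.
  by rewrite !andbT -card_gt0 ti.
- by rewrite inE eqxx.
- move=> t; rewrite inE => /andP[_ ts]; rewrite ltnNge.
  by rewrite (leq_trans (subset_leq_card ts) sr).
- exact: simplex_prob_dim.
Qed.

Lemma mean_sum (I : finType) (P : pred I) (f : I -> {set {set 'I_n}} -> R) :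
  mean p (fun Y => \sum_(i | P i) f i Y) = \sum_(i | P i) mean p (f i).
Proof.
by rewrite /mean exchange_big; apply: eq_bigr => Y _; rewrite mulr_sumr.
Qed.

(** Linearity of expectation; with A the sets of cardinality m + 1 it gives the
    expected face numbers, with A those through a vertex the expected degrees. *)
Lemma mean_count (A : {set {set 'I_n}}) m :
    (forall s, s \in A -> #|s| = m.+1) -> (m <= r)%N ->
  mean p (fun Y => #|A :&: Y|%:R) =
  #|A|%:R * \prod_(i < r.+1) p i ^+ 'C(m.+1, i.+1).
Proof.
move=> Am mr.
transitivity (mean p (fun Y => \sum_(s in A) (s \in Y)%:R)).
  apply: eq_bigr => Y _; congr (_ * _); rewrite -natr_sum -sum1_card; congr _%:R.
  rewrite (bigID (mem Y)) /= [in RHS](bigID (mem Y)) /=.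
  rewrite [X in (_ + X)%N]big1 ?[X in (_ = _ + X)%N]big1.
  - rewrite !addn0; apply: eq_big => s; rewrite !inE; first by case: (s \in A); case: (s \in Y).
    by case/andP => /andP[_ ->].
  - by move=> s /andP[_ /negbTE ->].
  - by move=> s; rewrite !inE => /andP[/andP[_ ->]].
rewrite mean_sum (eq_bigr (fun=> \prod_(i < r.+1) p i ^+ 'C(m.+1, i.+1))).
  by rewrite sumr_const mulr_natl.
by move=> s sA; rewrite mean_face ?(Am _ sA) // -card_gt0 (Am _ sA).
Qed.

Hypothesis p01 : forall i, 0 <= p i <= 1.

Lemma prob_ge0 Y : 0 <= prob p Y.
Proof.
by apply: mulr_ge0; apply: prodr_ge0 => i _; apply: exprn_ge0;
  have /andP[? ?] := p01 i; rewrite ?subr_ge0.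
Qed.

Lemma ler_mean (f g : {set {set 'I_n}} -> R) :
  (forall Y, Y \in Omega n r -> f Y <= g Y) -> mean p f <= mean p g.
Proof.
by move=> fg; apply: ler_sum => Y YO; apply: (ler_wpM2l (prob_ge0 Y)); apply: fg.
Qed.

End Coupling.

(** * Face numbers, Betti numbers and boundary ranks *)

Section Homology.
Variable n : nat.
Implicit Types (Y A : {set {set 'I_n}}) (s t : {set 'I_n}) (c : chain n).

Lemma dim_chains Y i : \dim (chains Y i) = #|faces Y i|.
Proof.
set X := [seq simplex_chain s | s in faces Y i].
suff /eqP -> : free X by rewrite size_map -cardE.
have sz : size X = size (enum (faces Y i)) by rewrite size_map.
apply: (introT (@freeP rat (chain n) _ (in_tuple X))) => a aX0 k.
have kY (l : 'I_(size X)) : (l < size (enum (faces Y i)))%N by rewrite -sz.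
have XE (l : 'I_(size X)) : X`_l = simplex_chain (nth finset.set0 (enum (faces Y i)) l).
  by rewrite /X (nth_map finset.set0); [|apply: kY].
have /(congr1 (fun c : chain n => c (nth finset.set0 (enum (faces Y i)) k))) := aX0.
rewrite sum_ffunE (bigD1 k) //= XE !ffunE eqxx big1 ?addr0.
  by move=> <-; symmetry; apply: mulr1.
move=> l lk; rewrite XE !ffunE nth_uniq; [|apply: kY|apply: kY|exact: enum_uniq].
by rewrite (eq_sym (k : nat)) (inj_eq val_inj) (negbTE lk) scaler0.
Qed.

Lemma dim_boundaries_le_faces_succ Y j : (\dim (boundaries Y j) <= #|faces Y j.+1|)%N.
Proof. by rewrite -dim_chains -(limg_ker_dim (boundary n) (chains Y j.+1)) leq_addl. Qed.

Lemma dim_boundaries_le_faces Y j :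
  is_complex Y -> (\dim (boundaries Y j) <= #|faces Y j|)%N.
Proof.
move=> cY; rewrite -dim_chains; apply: dimvS.
by apply: subv_trans (boundaries_cycles j cY) _; apply: capvSl.
Qed.

Lemma dim_cycles Y j :
  is_complex Y -> \dim (cycles Y j) = (betti Y j + \dim (boundaries Y j))%N.
Proof.
by move=> cY; rewrite betti_dim // subnK //; apply/dimvS/boundaries_cycles.
Qed.

(** Rank-nullity for the boundary map, with b + rho in place of the dimension of
    the cycles. *)
Lemma faces_bettiS Y j : is_complex Y ->
  #|faces Y j.+1| =
  (betti Y j.+1 + \dim (boundaries Y j.+1) + \dim (boundaries Y j))%N.
Proof.
move=> cY; rewrite -dim_cycles // -dim_chains.
by rewrite -(limg_ker_dim (boundary n) (chains Y j.+1)).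
Qed.

(** In degree 0 every chain is a cycle because homology is not reduced. *)
Lemma faces_betti0 Y : is_complex Y ->
  #|faces Y 0| = (betti Y 0 + \dim (boundaries Y 0))%N.
Proof.
move=> cY; rewrite -dim_cycles // -dim_chains; congr (\dim _).
symmetry; apply/capv_idPl/subvP => c; rewrite mem_chains => /forallP cc.
rewrite memv_ker lfunE /=; apply/eqP/ffunP => t; rewrite !ffunE.
case: ifPn => // t0; rewrite big1 // => v vt.
have /(implyP (cc _))/eqP -> : v |: t \notin faces Y 0; last by rewrite mulr0.
by rewrite !inE cardsU1 vt add1n eqSS cards_eq0 (negbTE t0) andbF.
Qed.

Lemma betti_le_faces Y j : is_complex Y -> (betti Y j <= #|faces Y j|)%N.
Proof.
case: j => [|j] cY; first by rewrite faces_betti0 // leq_addr.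
by rewrite faces_bettiS // -addnA leq_addr.
Qed.

(** The boundary map is injective on the chains carried by the star of v0: the
    coefficient of the boundary of c at s minus v0 is, up to sign, c s, since
    v0 is the only vertex whose addition to s minus v0 gives a set of the star. *)
Lemma star_le_dim_boundaries Y j (v0 : 'I_n) :
  (#|[set s : {set 'I_n} | v0 \in s & #|s| == j.+2] :&: Y|
     <= \dim (boundaries Y j))%N.
Proof.
set S := _ :&: Y.
(* S is not a complex, but its simplexes are exactly its faces of dimension
   j + 1, so that its chains are the chains carried by the star. *)
have SE : faces S j.+1 = S.
  by apply/setP => s; rewrite !inE; case: eqP; rewrite ?andbT ?andbF.
have SY : (chains S j.+1 <= chains Y j.+1)%VS.
  apply/subvP => c; rewrite !mem_chains => /forallP cS; apply/forallP => s.
  apply/implyP => sY; apply: (implyP (cS s)); apply: contra sY.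
  by rewrite SE !inE => /andP[/andP[_ ->] ->].
apply: leq_trans (dimvS (limgS (boundary n) SY)).
rewrite -[in X in (X <= _)%N]SE -dim_chains.
rewrite -(limg_ker_dim (boundary n) (chains S j.+1)).
suff -> : (chains S j.+1 :&: lker (boundary n) = 0)%VS by rewrite dimv0.
apply/eqP; rewrite -subv0; apply/subvP => c.
rewrite memv_cap memv_ker lfunE /= memv0 mem_chains SE => /andP[/forallP cS /eqP bc].
have cS0 t : t \notin S -> c t = 0 by move=> /(implyP (cS t))/eqP.
apply/eqP/ffunP => s; rewrite [RHS]ffunE; have [sS|/cS0//] := boolP (s \in S).
have /andP[/andP[vs /eqP sj] sY] : (v0 \in s) && (#|s| == j.+2) && (s \in Y).
  by move: sS; rewrite !inE.
have := congr1 (fun d : chain n => d (s :\ v0)) bc; rewrite !ffunE.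
rewrite -cards_eq0; have := cardsD1 v0 s; rewrite vs sj add1n => -[<-] /=.
rewrite (bigD1 v0) /=; last by rewrite !inE eqxx.
rewrite big1 ?addr0 => [|v /andP[vs' vv0]].
  rewrite finset.setD1K // => /eqP; rewrite mulf_eq0 signr_eq0 /= => /eqP //.
rewrite cS0 ?mulr0 // !inE eqxx eq_sym (negbTE vv0) //.
Qed.

End Homology.

(** * Expected face numbers and their growth exponents *)

Lemma sum_bin_hockey (i m : nat) : (\sum_(s < m) 'C(s, i))%N = 'C(m, i.+1).
Proof. by elim: m => [|m IH]; rewrite ?big_ord0 // big_ord_recr /= IH binS. Qed.

Lemma powR_sum (R : realType) (x : R) (I : finType) (P : pred I) (f : I -> R) :
  x != 0 -> x `^ (\sum_(i | P i) f i) = \prod_(i | P i) x `^ f i.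
Proof.
move=> x0; apply: (big_morph (fun a => x `^ a)) => [a b|]; last by rewrite powRr0.
by rewrite powRD // x0 implybT.
Qed.

Lemma card_star n (v0 : 'I_n) m :
  #|[set s : {set 'I_n} | v0 \in s & #|s| == m.+1]| = 'C(n.-1, m).
Proof.
set S := [set s | _ & _].
have := cardsID [set s : {set 'I_n} | v0 \in s] [set s : {set 'I_n} | #|s| == m.+1].
have -> : [set s : {set 'I_n} | #|s| == m.+1] :&: [set s : {set 'I_n} | v0 \in s] = S.
  by apply/setP => s; rewrite !inE andbC.
have -> : [set s : {set 'I_n} | #|s| == m.+1] :\: [set s : {set 'I_n} | v0 \in s] =
          [set s : {set 'I_n} | s \subset [set~ v0] & #|s| == m.+1].
  by apply/setP => s; rewrite !inE finset.subsetC finset.sub1set inE.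
rewrite cards_draws card_draws cardsC1 card_ord.
have n0 : (0 < n)%N by apply: leq_ltn_trans (ltn_ord v0).
by rewrite -[in RHS](prednK n0) binS addnC => /addnI.
Qed.

Section Growth.
Variables (R : realType) (r : nat) (alpha : 'I_r.+1 -> R).

(** The exponent of n in the expected number of j-faces; it is the sum of the
    1 - psi_i for i <= j. *)
Definition growth (j : nat) : R := j.+1%:R - \sum_(i < j.+1) psi i alpha.

Lemma growthS j : growth j.+1 = growth j + (1 - psi j.+1 alpha).
Proof. by rewrite /growth big_ord_recr /= -natr1; ring. Qed.

(** The hockey-stick identity turns the exponents C(m, i+1), which count the faces
    of a simplex, into a sum of the functions psi. *)
Lemma sum_psi m :
  \sum_(s < m) psi s alpha = \sum_(i < r.+1) 'C(m, i.+1)%:R * alpha i.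
Proof.
rewrite exchange_big /=; apply: eq_bigr => i _.
by rewrite -mulr_suml -natr_sum sum_bin_hockey.
Qed.

Lemma prod_p_alpha n m : (0 < n)%N ->
  \prod_(i < r.+1) p_alpha alpha n i ^+ 'C(m, i.+1) =
  n%:R `^ (- \sum_(s < m) psi s alpha).
Proof.
move=> n0; rewrite sum_psi -sumrN powR_sum ?pnatr_eq0 -?lt0n //.
apply: eq_bigr => i _; rewrite /p_alpha -powR_mulrn ?powR_ge0 // -powRrM.
by congr (_ `^ _); ring.
Qed.

Lemma growth_powR n j : (0 < n)%N ->
  n%:R `^ growth j = n%:R ^+ j.+1 * n%:R `^ (- \sum_(s < j.+1) psi s alpha).
Proof.
by move=> n0; rewrite /growth powRD ?powR_mulrn // pnatr_eq0 -lt0n n0 implybT.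
Qed.

Hypothesis alpha_ge0 : forall i, 0 <= alpha i.

Lemma psi_homo a b : (a <= b)%N -> psi a alpha <= psi b alpha.
Proof.
move=> ab; apply: ler_sum => i _; apply: ler_wpM2r => //.
by rewrite ler_nat leq_bin2l.
Qed.

Lemma p_alpha_itv n i : 0 <= p_alpha alpha n i <= 1.
Proof.
rewrite /p_alpha powR_ge0 /=; case: n => [|n].
  by rewrite /powR eqxx; case: eqP => _; rewrite ?lexx ?ler01.
by rewrite -[leRHS](powRr0 n.+1%:R) ler_powR ?ler1n // oppr_le0.
Qed.

Lemma e_alpha_le i : (i <= r)%N -> e_alpha alpha <= `|1 - psi i alpha|.
Proof.
by move=> ir; apply: (@bigmin_le_cond _ _ _ _ (Ordinal (ir : (i < r.+1)%N))).
Qed.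

Variable k : 'I_r.+1.
Hypothesis alphaD : domainD k alpha.

Lemma e_alpha_gt0 : 0 < e_alpha alpha.
Proof.
have [_ lt1 gt1] := alphaD.
have pos i : (i < r.+1)%N -> 0 < `|1 - psi i alpha|.
  move=> ir; rewrite normr_gt0 subr_eq0; have [ik|ki] := leqP i k.
    by rewrite gt_eqF // (le_lt_trans (psi_homo ik)).
  by rewrite lt_eqF // (lt_le_trans (gt1 _) (psi_homo ki)) // (leq_trans ki).
by apply: lt_bigmin => [|i _]; apply: pos.
Qed.

Lemma e_alpha_le_below i : (i <= k)%N -> e_alpha alpha <= 1 - psi i alpha.
Proof.
have [_ lt1 _] := alphaD => ik.
have := e_alpha_le (leq_trans ik (ltn_ord k)); rewrite ger0_norm // subr_ge0.
exact/ltW/(le_lt_trans (psi_homo ik)).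
Qed.

Lemma e_alpha_le_above i : (k < i <= r)%N -> e_alpha alpha <= psi i alpha - 1.
Proof.
have [_ _ gt1] := alphaD => /andP[ki ir].
have := e_alpha_le ir; rewrite ler0_norm ?opprB // subr_le0.
by apply/ltW/(lt_le_trans (gt1 _) (psi_homo ki))/(leq_trans ki).
Qed.

Lemma growth_gap_below m j :
  (j + m <= k)%N -> growth j + m%:R * e_alpha alpha <= growth (j + m).
Proof.
elim: m => [|m IH]; first by rewrite mul0r addr0 addn0.
rewrite addnS => jk; have := IH (ltnW jk); have := e_alpha_le_below jk.
by rewrite growthS -natr1; lra.
Qed.

Lemma growth_gap_above m :
  (0 < m)%N -> (k + m <= r)%N -> growth (k + m) + e_alpha alpha <= growth k.
Proof.
have e0 := e_alpha_gt0.
case: m => // m _; elim: m => [|m IH] kr.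
  rewrite addn1 growthS; have := @e_alpha_le_above k.+1; rewrite ltnSn -addn1 => /(_ kr).
  by rewrite addn1; lra.
have := IH (leq_trans (leq_add (leqnn _) (leqnSn _)) kr).
have := @e_alpha_le_above (k + m.+2)%N; rewrite kr andbT -addSnnS leq_addr => /(_ isT).
by rewrite addSnnS [in growth (k + m.+2)]addnS growthS addnS; lra.
Qed.

(** All increments 1 - psi_i between j and k have the same sign, and each is at
    least e(alpha) in absolute value. *)
Lemma growth_gap j :
  (j <= r)%N -> j != k :> nat -> growth j + e_alpha alpha <= growth k.
Proof.
move=> jr; rewrite neq_ltn => /orP[jk|kj].
  have e0 := e_alpha_gt0.
  have := @growth_gap_below (k - j) j; rewrite subnKC ?(ltnW jk) // => /(_ (leqnn _)).
  apply: le_trans; rewrite lerD2l ler_peMl ?(ltW e0) // ler1n subn_gt0 //.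
have := @growth_gap_above (j - k); rewrite subnKC ?(ltnW kj) // subn_gt0.
exact.
Qed.

End Growth.

Section MeanBetti.
Variables (R : realType) (r : nat) (alpha : 'I_r.+1 -> R).
Hypothesis alpha_ge0 : forall i, 0 <= alpha i.

Definition mean_faces n j : R :=
  mean (p_alpha alpha n) (fun Y : {set {set 'I_n}} => #|faces Y j|%:R).

Definition mean_rank n j : R :=
  mean (p_alpha alpha n)
    (fun Y : {set {set 'I_n}} => (\dim (boundaries Y j))%:R).

Lemma mean_facesE n j : (0 < n)%N -> (j <= r)%N ->
  mean_faces n j =
  'C(n, j.+1)%:R * n%:R `^ (- \sum_(s < j.+1) psi s alpha).
Proof.
move=> n0 jr; rewrite -prod_p_alpha // -[in 'C(n, _)](card_ord n) -card_draws.
rewrite -mean_count //; last by move=> s; rewrite inE => /eqP.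
apply: eq_bigr => Y _; congr (_ * _%:R); congr #|pred_of_set _|.
by apply/setP => s; rewrite !inE andbC.
Qed.

Lemma Omega_complex n (Y : {set {set 'I_n}}) : Y \in Omega n r -> is_complex Y.
Proof. by rewrite inE => /andP[]. Qed.

Lemma faces_big n (Y : {set {set 'I_n}}) j :
  Y \in Omega n r -> (r < j)%N -> #|faces Y j| = 0%N.
Proof.
rewrite inE => /andP[_ /forall_inP Yr] rj; apply/eqP; rewrite cards_eq0.
apply/eqP/setP => s; rewrite !inE; apply/negP => /andP[/Yr sr /eqP sj].
by move: sr; rewrite sj ltnS leqNgt rj.
Qed.

Lemma mean_facesS n j :
  mean_faces n j.+1 = mean_betti alpha n j.+1 + mean_rank n j.+1 + mean_rank n j.
Proof.
rewrite /mean_faces /mean_betti /mean_rank /mean -!big_split /=.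
apply: eq_bigr => Y /Omega_complex YO.
by rewrite faces_bettiS // !natrD !mulrDr.
Qed.

Lemma mean_faces0 n : mean_faces n 0 = mean_betti alpha n 0 + mean_rank n 0.
Proof.
rewrite /mean_faces /mean_betti /mean_rank /mean -!big_split /=.
apply: eq_bigr => Y /Omega_complex YO.
by rewrite faces_betti0 // !natrD !mulrDr.
Qed.

Lemma mean_betti_ge0 n j : 0 <= mean_betti alpha n j.
Proof.
by apply: sumr_ge0 => Y _; rewrite mulr_ge0 // prob_ge0 // => i; apply: p_alpha_itv.
Qed.

Lemma mean_betti_le_faces n j : mean_betti alpha n j <= mean_faces n j.
Proof.
apply: ler_mean => [i|Y /Omega_complex YO]; first exact: p_alpha_itv.
by rewrite ler_nat betti_le_faces.
Qed.

Lemma mean_rank_le n j : mean_rank n j <= mean_faces n j.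
Proof.
apply: ler_mean => [i|Y /Omega_complex YO]; first exact: p_alpha_itv.
by rewrite ler_nat dim_boundaries_le_faces.
Qed.

Lemma mean_rank_leS n j : mean_rank n j <= mean_faces n j.+1.
Proof.
apply: ler_mean => [i|Y /Omega_complex YO]; first exact: p_alpha_itv.
by rewrite ler_nat dim_boundaries_le_faces_succ.
Qed.

Lemma mean_rank_top n : mean_rank n r <= 0.
Proof.
apply: le_trans (mean_rank_leS n r) _.
rewrite /mean_faces /mean big1 // => Y YO.
by rewrite (faces_big YO) // mulr0.
Qed.

Lemma star_le_mean_rank n j : (0 < n)%N -> (j < r)%N ->
  'C(n.-1, j.+1)%:R * n%:R `^ (- \sum_(s < j.+2) psi s alpha) <= mean_rank n j.
Proof.
move=> n0 jr; rewrite -(card_star (Ordinal n0)) -prod_p_alpha // -mean_count //; last first.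
  by move=> s; rewrite inE => /andP[_ /eqP].
apply: ler_mean => [i|Y YO]; first exact: p_alpha_itv.
by rewrite ler_nat star_le_dim_boundaries.
Qed.

Lemma mean_faces_growth n j : (0 < n)%N -> (j <= r)%N ->
  mean_faces n j = (n ^_ j.+1)%:R / n%:R ^+ j.+1 * (n%:R `^ growth alpha j / j.+1`!%:R).
Proof.
move=> n0 jr; rewrite mean_facesE // growth_powR // -bin_ffact natrM.
by field; rewrite expf_neq0 pnatr_eq0 -lt0n ?fact_gt0.
Qed.

Lemma mean_faces_le n j : (0 < n)%N -> (j <= r)%N ->
  mean_faces n j <= n%:R `^ growth alpha j / j.+1`!%:R.
Proof.
move=> n0 jr; rewrite mean_faces_growth // ler_piMl //.
rewrite ler_pdivrMr ?exprn_gt0 ?ltr0n // mul1r -natrX ler_nat.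
rewrite ffact_prod -[X in (_ <= _ ^ X)%N](card_ord j.+1) -prod_nat_const.
by apply: leq_prod => i _; rewrite leq_subr.
Qed.

End MeanBetti.

Local Open Scope classical_set_scope.
Local Open Scope ring_scope.

(** * The asymptotics of the expected Betti numbers *)

Lemma powR_nat_ge_near (R : realType) (d A : R) :
  0 < d -> \forall n \near \oo, A <= n%:R `^ d.
Proof.
move=> d0; near=> n; pose B := Num.max A 0.
apply: (@le_trans _ _ B); first by rewrite /B le_max lexx.
have B0 : 0 <= B by rewrite /B le_max lexx orbT.
rewrite -[leLHS](@powRr1 _ B) // -[in leLHS](@mulVf _ d) ?gt_eqF // powRrM.
apply: ge0_ler_powR; rewrite ?(ltW d0) ?nnegrE ?powR_ge0 ?ler0n //.
by near: n; exact: nbhs_infty_ger.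
Unshelve. all: by end_near. Qed.

Lemma powR_nat_cvg0 (R : realType) (d : R) :
  0 < d -> (n%:R `^ (- d) : R) @[n --> \oo] --> (0 : R).
Proof.
move=> d0; apply/cvgrPdist_le => eps eps0; near=> n.
rewrite sub0r normrN ger0_norm ?powR_ge0 // powRN invf_ple ?posrE //.
  by near: n; apply: powR_nat_ge_near.
by apply: powR_gt0; rewrite ltr0n; near: n; exact: nbhs_infty_gt.
Unshelve. all: by end_near. Qed.

Lemma ffact_powR_cvg1 (R : realType) m :
  ((n ^_ m)%:R / n%:R ^+ m : R) @[n --> \oo] --> (1 : R).
Proof.
elim: m => [|m IH].
  under eq_fun do rewrite ffactn0 expr0 divr1.
  exact: cvg_cst.
have lin : ((n - m)%:R / n%:R : R) @[n --> \oo] --> (1 : R).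
  have : (1 - m%:R * n%:R `^ (- 1) : R) @[n --> \oo] --> (1 - m%:R * 0 : R).
    apply: cvgB; first exact: cvg_cst.
    by apply: cvgM; [exact: cvg_cst|exact: powR_nat_cvg0].
  rewrite mulr0 subr0; apply: cvg_trans; apply: near_eq_cvg; near=> n.
  have n0 : (0 < n)%N by near: n; exact: nbhs_infty_gt.
  have mn : (m <= n)%N by near: n; exact: nbhs_infty_ge.
  rewrite powR_inv1 // natrB // mulrBl divff // pnatr_eq0 -lt0n //.
have : ((n ^_ m)%:R / n%:R ^+ m * ((n - m)%:R / n%:R) : R) @[n --> \oo] --> (1 * 1 : R).
  exact: (cvgM IH lin).
rewrite mulr1; apply: cvg_trans.
apply: near_eq_cvg; near=> n.
by rewrite /= ffactnSr natrM exprSr mulf_div.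
Unshelve. all: by end_near. Qed.

Section Asymptotics.
Variables (R : realType) (r : nat) (alpha : 'I_r.+1 -> R).
Hypothesis alpha_ge0 : forall i, 0 <= alpha i.
Variable k : 'I_r.+1.
Hypothesis alphaD : domainD k alpha.

Let leading n : R := k.+1`!%:R^-1 * n%:R `^ growth alpha k.

(** The constants 1 / (j+1)! are bounded by 1, as only the order of magnitude of
    the non-critical face numbers matters. *)
Lemma mean_faces_small n j : (0 < n)%N -> (j <= r)%N -> j != k :> nat ->
  mean_faces alpha n j <= n%:R `^ growth alpha k * n%:R `^ (- e_alpha alpha).
Proof.
move=> n0 jr jk; apply: le_trans (mean_faces_le alpha n0 jr) _.
apply: (@le_trans _ _ (n%:R `^ growth alpha j)).
  by rewrite ler_piMr ?powR_ge0 // invf_le1 ?ltr0n ?fact_gt0 // ler1n fact_gt0.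
rewrite -powRD ?pnatr_eq0 -?lt0n ?n0 ?implybT //; apply: ler_powR; rewrite ?ler1n //.
by rewrite lerBrDr growth_gap.
Qed.

(** For k = r there are no faces of dimension k + 1, and the rank vanishes. *)
Lemma mean_rank_small n : (0 < n)%N ->
  mean_rank alpha n k <= n%:R `^ growth alpha k * n%:R `^ (- e_alpha alpha).
Proof.
move=> n0; have [kr|rk] := ltnP k r.
  apply: le_trans (mean_rank_leS alpha_ge0 n k) _.
  by apply: mean_faces_small => //; rewrite neq_ltn ltnSn orbT.
have -> : (k : nat) = r by apply/eqP; rewrite eqn_leq rk -ltnS ltn_ord.
apply: le_trans (mean_rank_top alpha_ge0 n) _.
by rewrite mulr_ge0 ?powR_ge0.
Qed.

(** The difference f_k - b_k is the sum of rho_k and rho_(k-1), bounded by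
    f_(k+1) and f_(k-1); for k = 0 only rho_0 occurs. *)
Lemma mean_betti_dominant n : (0 < n)%N ->
  mean_faces alpha n k <= mean_betti alpha n k +
    2 * (n%:R `^ growth alpha k * n%:R `^ (- e_alpha alpha)).
Proof.
move=> n0; have small := mean_rank_small n0.
case: (posnP k) => [k0|k0].
  have : 0 <= n%:R `^ growth alpha k * n%:R `^ (- e_alpha alpha).
    by rewrite mulr_ge0 ?powR_ge0.
  by move: small; rewrite k0 mean_faces0; lra.
have k1 : k.-1.+1 = k :> nat by rewrite prednK.
have : mean_rank alpha n k.-1 <= n%:R `^ growth alpha k * n%:R `^ (- e_alpha alpha).
  apply: le_trans (mean_rank_le alpha_ge0 n k.-1) _; apply: mean_faces_small => //.
    by rewrite (leq_trans (leq_pred k)) // -ltnS.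
  by rewrite -[X in _ != X]k1 neq_ltn ltnSn.
by have := mean_facesS alpha n k.-1; rewrite k1; lra.
Qed.

Lemma leading_gt0 n : (0 < n)%N -> 0 < leading n.
Proof.
by move=> n0; rewrite mulr_gt0 ?powR_gt0 ?invr_gt0 ?ltr0n ?fact_gt0.
Qed.

(** After division by the leading term, E f_k becomes n (n-1) ... (n-k) / n^(k+1),
    and the two ranks contribute at most 2 (k+1)! n^(-e(alpha)). *)
Lemma mean_betti_cvg : mean_betti alpha n k / leading n @[n --> \oo] --> (1 : R).
Proof.
pose lower (n : nat) : R := (n ^_ k.+1)%:R / n%:R ^+ k.+1 -
  2 * k.+1`!%:R * n%:R `^ (- e_alpha alpha).
apply: (@squeeze_cvgr _ _ _ _ lower (fun n => (n ^_ k.+1)%:R / n%:R ^+ k.+1)).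
- near=> n; have n0 : (0 < n)%N by near: n; exact: nbhs_infty_gt.
  have kr : (k <= r)%N by rewrite -ltnS.
  have E : mean_faces alpha n k = (n ^_ k.+1)%:R / n%:R ^+ k.+1 * leading n.
    by rewrite mean_faces_growth // /leading [_^-1 * _]mulrC.
  rewrite ler_pdivlMr ?ler_pdivrMr ?leading_gt0 // -E mean_betti_le_faces // andbT.
  rewrite mulrBl -E lerBlDr; apply: le_trans (mean_betti_dominant n0) _.
  rewrite lerD2l /leading -!mulrA ler_pM2l //.
  rewrite [X in _ <= _ * X]mulrCA mulVKf ?pnatr_eq0 -?lt0n ?fact_gt0 //.
  by rewrite mulrC.
- have -> : (1 : R) = 1 - 2 * k.+1`!%:R * 0 by rewrite mulr0 subr0.
  apply: cvgB; first exact: ffact_powR_cvg1.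
  apply: cvgM; first exact: cvg_cst.
  exact/powR_nat_cvg0/(e_alpha_gt0 alpha_ge0 alphaD).
- exact: ffact_powR_cvg1.
Unshelve. all: by end_near. Qed.

End Asymptotics.

(** * Dominance of the critical Betti number *)

Section Dominance.
Variables (R : realType) (r : nat) (alpha : 'I_r.+1 -> R).
Hypothesis alpha_ge0 : forall i, 0 <= alpha i.
Variable k : 'I_r.+1.
Hypothesis alphaD : domainD k alpha.

(** The tight case. With y = n^(1 - psi_1) >= n^(e(alpha)) and P the probability of
    an edge, y E f_0 = n^2 P and 2 E f_1 = n (n-1) P. Substituting
    b_0 = f_0 - rho_0 and b_1 = f_1 - rho_0, the claim reduces to
    n P / 2 <= (y / 2 - 1) E rho_0. This holds for y >= 4 because
    E rho_0 is at least the expected degree (n-1) P of a vertex. *)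
Lemma graph_dominance n : r = 1%N -> k = 1%N :> nat ->
    (1 < n)%N -> 4 <= n%:R `^ e_alpha alpha ->
  n%:R `^ e_alpha alpha / 2 * mean_betti alpha n 0 <= mean_betti alpha n 1.
Proof.
move=> r1 k1 n1 x4; have n0 := ltnW n1; have n0R : n%:R != 0 :> R by rewrite pnatr_eq0 -lt0n.
set x := n%:R `^ _ in x4 *; pose y : R := n%:R `^ (1 - psi 1 alpha).
have xy : x <= y.
  by apply: ler_powR; [rewrite ler1n|apply: (e_alpha_le_below alpha_ge0 alphaD); rewrite k1].
have r0 : (0 < r)%N by rewrite r1.
pose P : R := n%:R `^ (- (\sum_(s < 2) psi s alpha)).
have F0y : mean_faces alpha n 0 * y = n%:R ^+ 2 * P.
  rewrite mean_facesE // bin1 -mulrA -powRD ?n0R ?implybT //.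
  rewrite (_ : - (\sum_(s < 1) psi s alpha) + _ = 1 + - (\sum_(s < 2) psi s alpha)); last first.
    by rewrite !big_ord_recr !big_ord0 /=; ring.
  by rewrite powRD ?n0R ?implybT // powRr1 // mulrA -expr2.
have F1 : 2 * mean_faces alpha n 1 = n%:R * (n%:R - 1) * P.
  rewrite mean_facesE // -/P mulrA; congr (_ * P).
  by rewrite -(natrB _ n0) -!natrM mulnC (bin_ffact n 2) ffactnS ffactn1 subn1.
have S0 : (n%:R - 1) * P <= mean_rank alpha n 0.
  by have := star_le_mean_rank alpha_ge0 n0 r0; rewrite bin1 -subn1 natrB.
have rank1 : mean_rank alpha n 1 <= 0 by have := mean_rank_top alpha_ge0 n; rewrite {2}r1.
have b0 := mean_betti_ge0 alpha_ge0 n 0.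
have N2 : 2 <= n%:R :> R by rewrite ler_nat.
have P0 : 0 <= P by apply: powR_ge0.
have rank0 : 0 <= mean_rank alpha n 0.
  by apply: le_trans S0; rewrite mulr_ge0 // subr_ge0 ler1n.
have xyb : 0 <= (y - x) * mean_betti alpha n 0 by rewrite mulr_ge0 ?subr_ge0.
have yrank : 0 <= (y - 4) * mean_rank alpha n 0.
  by rewrite mulr_ge0 // subr_ge0 (le_trans x4).
have NP : 0 <= (n%:R - 2) * P by rewrite mulr_ge0 ?subr_ge0.
have faces1 := mean_facesS alpha n 0.
move: F0y F1; rewrite mean_faces0 faces1; lra.
Qed.

(** For given n, the inequality follows as soon as n^e(alpha) >= 4 and E b_k has
    reached half of its leading term. *)
Lemma betti_dominance n j : (1 < n)%N -> 4 <= n%:R `^ e_alpha alpha ->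
    n%:R `^ growth alpha k / (2 * k.+1`!%:R) <= mean_betti alpha n k ->
    (j <= r)%N -> j != k :> nat ->
  n%:R `^ e_alpha alpha / r.+1`!%:R * mean_betti alpha n j <= mean_betti alpha n k.
Proof.
move=> n1 x4 half jr jk; have n0 := ltnW n1.
have n0R : n%:R != 0 :> R by rewrite pnatr_eq0 -lt0n.
have kr : (k <= r)%N by rewrite -ltnS.
have fpos m : 0 < m`!%:R :> R by rewrite ltr0n fact_gt0.
have bj := le_trans (mean_betti_le_faces alpha_ge0 n j) (mean_faces_le alpha n0 jr).
(* The constant c measures what is gained in the exponent: c = 1 when the
   factorials already absorb the factor 1 / 2, and c = 1 / 2 when j = 0 and k = r,
   where they do not. *)
have weak (c : R) :
    n%:R `^ e_alpha alpha * n%:R `^ growth alpha j <= c * n%:R `^ growth alpha k ->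
    c * (2 * k.+1`!%:R) <= r.+1`!%:R * j.+1`!%:R ->
    n%:R `^ e_alpha alpha / r.+1`!%:R * mean_betti alpha n j <= mean_betti alpha n k.
  move=> gap cf; apply: le_trans half.
  apply: (@le_trans _ _ (n%:R `^ e_alpha alpha / r.+1`!%:R *
                         (n%:R `^ growth alpha j / j.+1`!%:R))).
    by apply: ler_wpM2l bj; rewrite divr_ge0 // powR_ge0.
  rewrite mulf_div ler_pdivrMr ?mulr_gt0 // mulrAC ler_pdivlMr ?mulr_gt0 //.
  apply: le_trans (ler_wpM2r _ gap) _; first by rewrite mulr_ge0 // ltW.
  by rewrite mulrAC mulrC ler_wpM2l ?powR_ge0.
have gap : n%:R `^ e_alpha alpha * n%:R `^ growth alpha j <= n%:R `^ growth alpha k.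
  rewrite -powRD ?n0R ?implybT //; apply: ler_powR; first by rewrite ler1n.
  by rewrite addrC growth_gap.
(* For j > 0 the factor 2 comes from (j+1)!, for k < r from (r+1)! / (k+1)!. *)
have f2 : (0 < j)%N || (k < r)%N -> (2 * k.+1`! <= r.+1`! * j.+1`!)%N.
  case/orP => [j0|k_lt_r].
    by rewrite mulnC leq_mul // ?leq_fact ?ltnS // (@leq_fact 2).
  rewrite -[leqLHS]muln1 leq_mul ?fact_gt0 //.
  by apply: leq_trans (leq_fact (k_lt_r : (k.+2 <= r.+1)%N)); rewrite factS leq_mul.
have [/f2 {}f2|] := boolP ((0 < j)%N || (k < r)%N).
  by apply: (weak 1); rewrite ?mul1r // -!natrM ler_nat.
rewrite negb_or -!leqNgt leqn0 => /andP[/eqP j0 rk].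
have kE : k = r :> nat by apply/eqP; rewrite eqn_leq kr.
have [r1|r_gt1] := leqP r 1.
  have {}r1 : r = 1%N.
    by apply/eqP; rewrite eqn_leq r1 -kE lt0n -j0 eq_sym.
  have k1 : k = 1%N :> nat by rewrite kE.
  by rewrite (_ : r.+1`! = 2%N) ?r1 // j0 k1; apply: graph_dominance.
apply: (weak (2^-1)); last first.
  by rewrite mulrA mulVf ?pnatr_eq0 // mul1r j0 mulr1 kE.
(* Here k = r >= 2, so at least two increments separate 0 from k. *)
have gap2 : e_alpha alpha + (e_alpha alpha + growth alpha j) <= growth alpha k.
  have := growth_gap_below alpha_ge0 alphaD (leqnn (0 + k)%N).
  have : 2 * e_alpha alpha <= k%:R * e_alpha alpha.
    by rewrite ler_pM2r ?(e_alpha_gt0 alpha_ge0 alphaD) // ler_nat kE.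
  by rewrite add0n j0; lra.
rewrite ler_pdivlMl //.
have : n%:R `^ (e_alpha alpha + (e_alpha alpha + growth alpha j)) <= n%:R `^ growth alpha k.
  by apply: ler_powR; rewrite ?ler1n.
rewrite !powRD ?n0R ?implybT //; apply: le_trans.
by rewrite ler_wpM2r ?mulr_ge0 ?powR_ge0 // (le_trans _ x4) // ler_nat.
Qed.

End Dominance.

Theorem theorem2 (R : realType) (r : nat) (alpha : 'I_r.+1 -> R)
    (alpha_ge0 : forall i : 'I_r.+1, 0 <= alpha i)
    (k : 'I_r.+1) (alphaD : domainD k alpha) :
  (\forall n \near \oo, forall j : 'I_r.+1, j != k ->
     n%:R `^ e_alpha alpha / (r.+1)`!%:R * mean_betti alpha n j
       <= mean_betti alpha n k) /\
  ((fun n : nat => mean_betti alpha n k /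
      ((k.+1)`!%:R^-1 *
       n%:R `^ (k.+1%:R - \sum_(i < k.+1) psi i alpha))) @ \oo --> (1 : R)).
Proof.
have cvg1 := mean_betti_cvg alpha_ge0 alphaD.
split; last exact: cvg1.
have half := cvgr_ge 1 cvg1 (2^-1 : R) _.
near=> n => j jk.
have n1 : (1 < n)%N by near: n; exact: nbhs_infty_gt.
apply: betti_dominance => //.
- by near: n; apply/powR_nat_ge_near/(e_alpha_gt0 alpha_ge0 alphaD).
- have : 2^-1 <= mean_betti alpha n k / (k.+1`!%:R^-1 * n%:R `^ growth alpha k).
    by near: n; apply: half; lra.
  rewrite ler_pdivlMr ?leading_gt0 // 1?ltnW //; apply: le_trans.
  by rewrite invfM [leLHS]mulrC mulrA.
- by rewrite -ltnS.
Unshelve. all: by end_near. Qed.
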